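(* Let $G=(V,E,A)$ be an attributed graph with exactly two attribute values, $A_{val}=\{a_1,a_2\}$, equipped with a fixed proper vertex coloring, and let $k$ be an integer. Then any strong fair clique of $G$ (with parameter $k$) is contained in the fairness $(k-1)$-core of $G$.
   Context: An attributed graph $G=(V,E,A)$ is a finite undirected, unweighted graph in which each vertex $u$ carries an attribute value $u.val$; $A_{val}=\{u.val : u\in V\}$. The vertices of $G$ are colored so that no two adjacent vertices have the same color. Subgraphs inherit attribute values and colors from $G$. Strong fair clique: given an integer $k$, a clique $C$ of $G$ is a strong fair clique if (1) for each $a_i\in A_{val}$, the number of vertices of $C$ with attribute value $a_i$ is at least $k$; (2) the number of vertices of $C$ with attribute value $a_i$ is the same for all $a_i\in A_{val}$; and (3) there is no clique $C'\supsetneq C$ satisfying (1) and (2). Fairness degree: for a vertex $u$, partition the neighbors of $u$ into groups, each group consisting of all neighbors having one given color. The fairness degree $FD(u)$ is the largest number of groups from which one can select vertices, one vertex per selected group, so that the number of selected vertices with attribute $a_1$ equals the number of selected vertices with attribute $a_2$. For a vertex $u$ of a subgraph $H$ of $G$, the fairness degree of $u$ in $H$ is computed with the neighbors of $u$ in $H$. Fairness $k$-core: a subgraph $H=(V_H,E_H,A)$ of $G$ is a fairness $k$-core if (1) $FD(u)\ge 2k$ for each $u\in V_H$, where the fairness degree is taken in $H$; and (2) there is no subgraph $H'\subseteq G$ satisfying (1) with $H\subsetneq H'$. *)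

(* Defs.v *)
From HB Require Import structures.
From mathcomp Require Import all_boot all_order all_algebra.
Set Implicit Arguments.
Unset Strict Implicit.
Unset Printing Implicit Defensive.
Import Order.TTheory GRing.Theory Num.Theory.

(* Simple graphs: an edge is an unordered pair [set u; v] with u != v. *)
Record attributed_graph (A : eqType) := AttributedGraph {
  vertex : finType;
  edges : {set {set vertex}};
  edgesP : [forall e in edges, #|e| == 2];
  attr : vertex -> A
}.

Definition proper_coloring (A K : eqType) (G : attributed_graph A)
    (color : vertex G -> K) : Prop :=
  forall u v : vertex G, [set u; v] \in edges G -> color u != color v.

(* Not necessarily induced, possibly empty. The side conditions are boolean,
   so Leibniz equality is equality of vertex and edge sets. *)
Record subgraph (A : eqType) (G : attributed_graph A) := Subgraph {
  sub_vertices : {set vertex G};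
  sub_edges : {set {set vertex G}};
  sub_edgesP :
    (sub_edges \subset edges G) && (sub_edges \subset powerset sub_vertices)
}.

Definition subgraph_le (A : eqType) (G : attributed_graph A)
    (H H' : subgraph G) : Prop :=
  sub_vertices H \subset sub_vertices H' /\ sub_edges H \subset sub_edges H'.

Definition subgraph_lt (A : eqType) (G : attributed_graph A)
    (H H' : subgraph G) : Prop :=
  subgraph_le H H' /\ H <> H'.

Fact induced_edgesP (A : eqType) (G : attributed_graph A)
    (S : {set vertex G}) :
  (edges G :&: powerset S \subset edges G)
  && (edges G :&: powerset S \subset powerset S).
Proof. by rewrite subsetIl subsetIr. Qed.

Definition induced (A : eqType) (G : attributed_graph A)
    (S : {set vertex G}) : subgraph G :=
  Subgraph (induced_edgesP S).

Definition clique (A : eqType) (G : attributed_graph A)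
    (C : {set vertex G}) : Prop :=
  {in C &, forall u v : vertex G, u != v -> [set u; v] \in edges G}.

Definition num_attr (A : eqType) (G : attributed_graph A)
    (S : {set vertex G}) (a : A) : nat :=
  #|[set u in S | attr u == a]|.

(* [codom attr] lists the attribute values that occur in G. *)
Definition fair (A : eqType) (G : attributed_graph A) (k : int)
    (C : {set vertex G}) : Prop :=
  {in codom (@attr A G), forall a : A, (k <= (num_attr C a)%:Z)%R} /\
  {in codom (@attr A G) &, forall a b : A, num_attr C a = num_attr C b}.

Definition strong_fair_clique (A : eqType) (G : attributed_graph A) (k : int)
    (C : {set vertex G}) : Prop :=
  [/\ clique C, fair k C &
      forall C' : {set vertex G}, C \proper C' -> clique C' -> ~ fair k C'].

Definition nbrs (A : eqType) (G : attributed_graph A) (H : subgraph G)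
    (u : vertex G) : {set vertex G} :=
  [set v | [set u; v] \in sub_edges H].

Definition color_groups (A K : eqType) (G : attributed_graph A)
    (color : vertex G -> K) (H : subgraph G) (u : vertex G) :
    {set {set vertex G}} :=
  preim_partition color (nbrs H u).

(* Q is the set of selected groups; a transversal S of Q is a choice of one
   vertex in each of them. *)
Definition fairness_degree (A K : eqType) (G : attributed_graph A)
    (color : vertex G -> K) (a1 a2 : A) (H : subgraph G) (u : vertex G) : nat :=
  \max_(Q : {set {set vertex G}} |
      (Q \subset color_groups color H u)
      && [exists S : {set vertex G}, is_transversal S Q (cover Q)
            && (num_attr S a1 == num_attr S a2)]) #|Q|.

Definition degree_fair (A K : eqType) (G : attributed_graph A)
    (color : vertex G -> K) (a1 a2 : A) (k : int) (H : subgraph G) : Prop :=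
  forall u : vertex G, u \in sub_vertices H ->
    (2 * k <= (fairness_degree color a1 a2 H u)%:Z)%R.

Definition fairness_core (A K : eqType) (G : attributed_graph A)
    (color : vertex G -> K) (a1 a2 : A) (k : int) (H : subgraph G) : Prop :=
  degree_fair color a1 a2 k H /\
  ~ (exists H' : subgraph G,
       degree_fair color a1 a2 k H' /\ subgraph_lt H H').

(* Main.v *)
(** The fairness degree is monotone in the neighborhood: a fair selection of
    color groups survives when the groups grow.  Hence the union of the vertex
    sets of all degree-fair subgraphs induces the greatest degree-fair
    subgraph, which is the core.  A strong fair clique is itself degree-fair
    for [k - 1]: its colors are pairwise distinct, so from [u] one may select
    every other vertex except one whose attribute is opposite to that of [u]. *)
Require Import Defs.
From HB Require Import structures.
From mathcomp Require Import all_boot all_order all_algebra.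
From mathcomp Require Import zify.
Set Implicit Arguments.
Unset Strict Implicit.
Unset Printing Implicit Defensive.
Import Order.TTheory GRing.Theory Num.Theory.

Lemma num_attrD1 (A : eqType) (G : attributed_graph A) (S : {set vertex G})
    (u : vertex G) (a : A) :
  u \in S -> num_attr (S :\ u) a = num_attr S a - (attr u == a).
Proof.
move=> uS; rewrite /num_attr (cardsD1 u [set v in S | attr v == a]).
rewrite inE uS /= addKn; apply: eq_card => v.
by rewrite !inE andbA.
Qed.

Lemma card_num_attr (A : eqType) (G : attributed_graph A) (a1 a2 : A)
    (S : {set vertex G}) :
  a1 != a2 -> codom (@attr A G) =i [:: a1; a2] ->
  #|S| = num_attr S a1 + num_attr S a2.
Proof.
move=> ha hval; rewrite -cardsUI.
rewrite (_ : _ :&: _ = set0) ?cards0 ?addn0.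
  apply: eq_card => v; rewrite !inE -andb_orr.
  by have := hval (attr v); rewrite codom_f !inE => <-; rewrite andbT.
apply/setP=> v; rewrite !inE; apply/negP=> /andP[/andP[_ /eqP->]].
by rewrite (negbTE ha) andbF.
Qed.

(** Neighbors with pairwise distinct colors lie in distinct color groups, so a balanced such set is
    a transversal of the groups it meets, and these number [#|S|]. Lower bounds on the fairness
    degree thus need no explicit family of groups. *)
Lemma fairness_degree_ge (A K : eqType) (G : attributed_graph A)
    (color : vertex G -> K) (a1 a2 : A) (H : subgraph G) (u : vertex G)
    (S : {set vertex G}) :
  S \subset nbrs H u -> {in S &, injective color} ->
  num_attr S a1 = num_attr S a2 -> #|S| <= fairness_degree color a1 a2 H u.
Proof.
move=> /subsetP SN injS balS; pose P := color_groups color H u.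
have /and3P[/eqP covP tiP nP0] : partition P (nbrs H u).
  exact: preim_partitionP.
have inP v : v \in S -> pblock P v \in P.
  by move=> vS; rewrite pblock_mem // covP SN.
(* Sharing a group means sharing a color, and [color] is injective on [S]. *)
have in_block x v : x \in S -> v \in S -> (v \in pblock P x) = (x == v).
  move=> xS vS; rewrite pblock_equivalence_partition ?SN //.
    by apply/eqP/eqP=> [/injS->|->].
  by split=> // /eqP->.
have selfP v : v \in S -> v \in pblock P v.
  by move=> vS; rewrite in_block.
have injP : {in S &, injective (pblock P)}.
  by move=> x y xS yS exy; apply/eqP; rewrite -in_block // exy selfP.
pose Q := [set pblock P v | v in S].
have QP : Q \subset P by apply/subsetP=> _ /imsetP[v vS ->]; exact: inP.
rewrite -(card_in_imset injP).
apply: (@leq_bigmax_cond _ _ (fun Q : {set {set vertex G}} => #|Q|) Q).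
rewrite QP /=; apply/existsP; exists S; rewrite balS eqxx andbT.
apply/and3P; split.
- apply/and3P; split=> //; first exact: trivIsetS tiP.
  by apply: contra nP0; exact: (subsetP QP).
- apply/subsetP=> v vS; apply/bigcupP; exists (pblock P v); last exact: selfP.
  exact: imset_f.
- apply/forall_inP=> _ /imsetP[v vS ->]; apply/cards1P; exists v.
  apply/setP=> w; rewrite !inE; have [wS|wNS] := boolP (w \in S) => /=.
    by rewrite in_block // eq_sym.
  by apply/esym/negP=> /eqP wv; rewrite wv vS in wNS.
Qed.

(** A group for [H] need not be a group for [H'], so the family [Q] itself cannot be reused. What
    carries over is its transversal, a balanced set of distinctly colored neighbors, to which
    [fairness_degree_ge] applies in [H']. *)
Lemma fairness_degree_mono (A K : eqType) (G : attributed_graph A)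
    (color : vertex G -> K) (a1 a2 : A) (H H' : subgraph G) (u : vertex G) :
  nbrs H u \subset nbrs H' u ->
  fairness_degree color a1 a2 H u <= fairness_degree color a1 a2 H' u.
Proof.
move=> sN; apply/bigmax_leqP=> Q /andP[QP /existsP[S /andP[trS /eqP balS]]].
rewrite -(card_transversal trS).
have /and3P[/eqP covP tiP _] := preim_partitionP color (nbrs H u).
have sS := transversal_sub trS.
have sQ : cover Q \subset nbrs H u.
  by rewrite -covP; apply/bigcupsP=> B BQ; apply: bigcup_sup (subsetP QP _ BQ).
apply: fairness_degree_ge balS; first exact: subset_trans (subset_trans sS sQ) sN.
(* Blocks of [Q] are entire color groups, so two vertices of [S] with equal color would share a
   block of [Q], where a transversal has only one vertex. *)
have blockQ x : x \in S -> pblock Q x = pblock (color_groups color H u) x.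
  move=> xS; have xQ := subsetP sS x xS.
  apply/esym/def_pblock; rewrite ?mem_pblock //.
  by apply: (subsetP QP); exact: pblock_mem.
move=> x y xS yS cxy; apply: (pblock_inj trS) => //; rewrite !blockQ //.
have [xN yN] : x \in nbrs H u /\ y \in nbrs H u.
  by split; apply: (subsetP sQ); apply: (subsetP sS).
apply/eqP; rewrite eq_pblock ?covP //.
rewrite pblock_equivalence_partition ?cxy //.
by split=> // /eqP->.
Qed.

Lemma nbrs_sub (A : eqType) (G : attributed_graph A) (H H' : subgraph G)
    (u : vertex G) :
  subgraph_le H H' -> nbrs H u \subset nbrs H' u.
Proof. by case=> _ /subsetP sE; apply/subsetP=> v; rewrite !inE => /sE. Qed.

Lemma subgraph_le_anti (A : eqType) (G : attributed_graph A)
    (H H' : subgraph G) :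
  subgraph_le H H' -> subgraph_le H' H -> H = H'.
Proof.
case: H H' => [V E p] [V' E' p'] [/= sV sE] [/= sV' sE'].
have eV : V = V' by apply/eqP; rewrite eqEsubset sV.
have eE : E = E' by apply/eqP; rewrite eqEsubset sE.
by subst V' E'; rewrite (bool_irrelevance p p').
Qed.

Lemma subgraph_le_trans (A : eqType) (G : attributed_graph A)
    (H1 H2 H3 : subgraph G) :
  subgraph_le H1 H2 -> subgraph_le H2 H3 -> subgraph_le H1 H3.
Proof.
by move=> [sV sE] [sV' sE']; split; [apply: subset_trans sV' | apply: subset_trans sE'].
Qed.

Lemma le_induced (A : eqType) (G : attributed_graph A) (H : subgraph G) :
  subgraph_le H (induced (sub_vertices H)).
Proof. by split=> //=; rewrite subsetI (sub_edgesP H). Qed.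

Lemma induced_le (A : eqType) (G : attributed_graph A)
    (S S' : {set vertex G}) :
  S \subset S' -> subgraph_le (induced S) (induced S').
Proof. by move=> sS; split=> //=; rewrite setIS // powersetS. Qed.

Lemma degree_fair_greatest (A K : eqType) (G : attributed_graph A)
    (color : vertex G -> K) (a1 a2 : A) (k : int) :
  exists2 H : subgraph G, degree_fair color a1 a2 k H &
    forall H', degree_fair color a1 a2 k H' -> subgraph_le H' H.
Proof.
pose FD := fairness_degree color a1 a2.
have FD_mono H H' u : subgraph_le H H' ->
    (2 * k <= (FD H u)%:Z)%R -> (2 * k <= (FD H' u)%:Z)%R.
  move=> leH /le_trans; apply; rewrite lez_nat.
  exact/fairness_degree_mono/nbrs_sub.
(* Vertex sets suffice: inducing on the vertices of a degree-fair subgraph only adds neighbors. A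
   boolean predicate on them can index the union. *)
pose fairb (S : {set vertex G}) :=
  [forall u in S, (2 * k <= (FD (induced S) u)%:Z)%R].
exists (induced (\bigcup_(S | fairb S) S)).
  move=> u /bigcupP[S fS uS]; apply: FD_mono (forall_inP fS u uS).
  exact/induced_le/bigcup_sup.
move=> H fH; apply: subgraph_le_trans (le_induced H) _.
apply/induced_le/bigcup_sup/forall_inP => u uH.
exact: FD_mono (le_induced H) (fH u uH).
Qed.

(** The core is defined by maximality only; a greatest element is maximal, and every other maximal
    element lies below it, hence equals it. *)
Lemma fairness_core_greatest (A K : eqType) (G : attributed_graph A)
    (color : vertex G -> K) (a1 a2 : A) (k : int) (H : subgraph G) :
  degree_fair color a1 a2 k H ->
  (forall H', degree_fair color a1 a2 k H' -> subgraph_le H' H) ->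
  unique (fairness_core color a1 a2 k) H.
Proof.
move=> fH maxH; split.
  by split=> // -[H' [/maxH leH' [leH neqH]]]; apply/neqH/subgraph_le_anti.
move=> H' [fH' maxH']; have leH' := maxH H' fH'.
apply: subgraph_le_anti => //.
(* Maximality of [H'] is a negated existence. If [H] were not below [H'], then [H] would be a
   strictly larger degree-fair subgraph. *)
have [sVE|NsVE] := boolP ((sub_vertices H \subset sub_vertices H') &&
                          (sub_edges H \subset sub_edges H')).
  by case/andP: sVE.
case: maxH'; exists H; do 2!split=> //.
by move=> eqH; rewrite eqH !subxx in NsVE.
Qed.

Lemma fair_clique_degree_fair (A K : eqType) (G : attributed_graph A)
    (a1 a2 : A) (color : vertex G -> K) (k : int) (C : {set vertex G}) :
  a1 != a2 -> codom (@attr A G) =i [:: a1; a2] -> proper_coloring color ->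
  clique C -> fair k C -> degree_fair color a1 a2 (k - 1)%R (induced C).
Proof.
move=> ha hval hcolor clC [geC balC] u /= uC.
have [in1 in2] : a1 \in codom (@attr A G) /\ a2 \in codom (@attr A G).
  by rewrite !hval !inE !eqxx orbT.
have eqC := balC a1 a2 in1 in2; have := geC a1 in1.
set n := num_attr C a1 in eqC *; move=> le_kn.
(* The vertex [u] makes the count of its own attribute positive; the counts being equal, the
   opposite attribute also occurs in [C]. *)
have [v vC att] : exists2 v, v \in C &
    (attr u == a1) && (attr v == a2) || (attr u == a2) && (attr v == a1).
  have ex a : 0 < num_attr C a -> exists2 v, v \in C & attr v == a.
    by case/card_gt0P=> v; rewrite inE => /andP[vC ?]; exists v.
  have pos a : attr u == a -> 0 < num_attr C a.
    by move=> ua; apply/card_gt0P; exists u; rewrite inE uC.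
  have := codom_f (@attr A G) u; rewrite hval !inE => /orP[] ua.
    have [|v vC va] := ex a2; first by rewrite -eqC pos.
    by exists v => //; rewrite ua va.
  have [|v vC va] := ex a1; first by rewrite -/n eqC pos.
  by exists v => //; rewrite ua va orbT.
have ha' : (a2 == a1) = false by rewrite eq_sym (negbTE ha).
have vCu : v \in C :\ u.
  rewrite !inE vC andbT; apply: contraTneq att => ->.
  apply/norP; split; apply/negP=> /andP[/eqP-> ]; last by rewrite ha'.
  by rewrite (negbTE ha).
pose S := C :\ u :\ v.
(* Removing [u] and [v] costs each attribute exactly one vertex. *)
have numS a : a \in [:: a1; a2] -> num_attr S a = n.-1.
  rewrite !inE /S !num_attrD1 // => /orP[] /eqP->; rewrite -?eqC -/n;
  case/orP: att => /andP[/eqP-> /eqP->]; rewrite ?eqxx ?(negbTE ha) ?ha'; lia.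
have n1 := numS a1 (mem_head _ _).
have n2 : num_attr S a2 = n.-1 by apply: numS; rewrite !inE eqxx orbT.
have SC x : x \in S -> x \in C by rewrite !inE => /and3P[].
have le_S : #|S| <= fairness_degree color a1 a2 (induced C) u.
  apply: fairness_degree_ge; last by rewrite n1 n2.
    apply/subsetP=> x xS; have xC := SC x xS; rewrite !inE clC //=.
      by rewrite subUset !sub1set uC.
    by move: xS; rewrite !inE (eq_sym u) => /and3P[].
  move=> x y /SC xC /SC yC cxy; apply/eqP/negPn/negP=> neq_xy.
  by have := hcolor x y (clC x y xC yC neq_xy); rewrite cxy eqxx.
(* The selection has [2 * n.-1] vertices, and [k <= n] gives [k - 1 <= n.-1], since truncation at
   zero can only raise the predecessor. *)
move: le_S; rewrite (card_num_attr S ha hval) n1 n2; lia.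
Qed.

Theorem lemma2 (A K : eqType) (G : attributed_graph A) (a1 a2 : A)
    (color : vertex G -> K) (k : int) (C : {set vertex G})
    (ha : a1 != a2)
    (hval : codom (@attr A G) =i [:: a1; a2])
    (hcolor : proper_coloring color)
    (hC : strong_fair_clique k C) :
  exists H : subgraph G,
    unique (fairness_core color a1 a2 (k - 1)%R) H /\
    subgraph_le (induced C) H.
Proof.
have [H fH maxH] := degree_fair_greatest color a1 a2 (k - 1)%R.
exists H; split; first exact: fairness_core_greatest.
by case: hC => clC fC _; apply/maxH/fair_clique_degree_fair.
Qed.
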